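(* A function $\phi\colon \mathbb{R}\to\mathbb{R}$ is a maximal general dual-feasible function (gDFF) if and only if all of the following conditions hold: (i) $\phi(0)=0$; (ii) $\phi$ is superadditive, i.e. $\phi(x)+\phi(y)\le\phi(x+y)$ for all $x,y\in\mathbb{R}$; (iii) $\phi(x)\ge 0$ for all real $x\ge 0$; (iv) $\phi$ satisfies the generalized symmetry condition: for every $r\in\mathbb{R}$, $\phi(r)=\inf\left\{\frac{1}{k}\bigl(1-\phi(1-kr)\bigr) : k \text{ a positive integer}\right\}$.
   Context: A function $\phi\colon\mathbb{R}\to\mathbb{R}$ is a (valid) general dual-feasible function (gDFF) if for every finite family $(x_i)_{i\in I}$ of real numbers (repetitions allowed), $\sum_{i\in I}x_i\le 1$ implies $\sum_{i\in I}\phi(x_i)\le 1$. A gDFF $\phi$ is maximal if there is no gDFF $\phi_1\ne\phi$ with $\phi_1(x)\ge\phi(x)$ for all $x\in\mathbb{R}$. *)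

(* Defs.v *)
From HB Require Import structures.
From mathcomp Require Import all_boot all_order all_algebra.
From mathcomp Require Import all_classical all_reals all_analysis.

Set Implicit Arguments.
Unset Strict Implicit.
Unset Printing Implicit Defensive.

Import Order.TTheory GRing.Theory Num.Theory.

Local Open Scope classical_set_scope.
Local Open Scope ring_scope.

Definition gDFF (R : realType) (phi : R -> R) : Prop :=
  forall (I : finType) (x : I -> R),
    \sum_(i : I) x i <= 1 -> \sum_(i : I) phi (x i) <= 1.

Definition maximal_gDFF (R : realType) (phi : R -> R) : Prop :=
  gDFF phi /\
  ~ exists phi1 : R -> R,
      [/\ gDFF phi1, phi1 <> phi & forall x : R, phi x <= phi1 x].

Definition superadditive (R : realType) (phi : R -> R) : Prop :=
  forall x y : R, phi x + phi y <= phi (x + y).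

(* The infimum is taken in the extended reals: the real-valued [inf] defaults
   to 0 on sets that are not bounded below. *)
Definition generalized_symmetry (R : realType) (phi : R -> R) : Prop :=
  forall r : R,
    (phi r)%:E =
    ereal_inf [set (k%:R^-1 * (1 - phi (1 - k%:R * r)))%:E
              | k in [set k : nat | (0 < k)%N]].

(* Main.v *)
Require Import Defs.
From HB Require Import structures.
From mathcomp Require Import all_boot all_order all_algebra.
From mathcomp Require Import all_classical all_reals all_analysis.

Set Implicit Arguments.
Unset Strict Implicit.
Unset Printing Implicit Defensive.

Import Order.TTheory GRing.Theory Num.Theory.

Local Open Scope ring_scope.

(** Suppose phi is maximal. If the value at r can be replaced by b without
    leaving the class of gDFFs, then b <= phi r: otherwise the new function
    would dominate phi strictly. A family meets the perturbed function in n
    copies of r and a list t that avoids r, so the replacement is admissible as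
    soon as n * r + sum t <= 1 implies n * b + sum phi(t) <= 1 for all n > 0
    ([maximal_gDFF_ge]). Each condition is one choice of (r, b):
    - b = 0 and r >= 0: dropping the copies of r only lowers the sum;
    - r = x + y and b = phi x + phi y: each copy of r splits into x and y;
    - b the infimum in the symmetry condition at r: by definition of b,
      n * b <= 1 - phi (1 - n * r), while superadditivity and monotonicity give
      sum phi(t) <= phi (sum t) <= phi (1 - n * r).
    The opposite inequality in the symmetry condition holds for every gDFF, by
    looking at k copies of r together with 1 - k * r ([gDFF_le_symmetry]).
    Likewise phi 0 <= 0 for every gDFF, by looking at n zeros for n large.

    Conversely, superadditivity and monotonicity bound sum phi(x_i) by phi 1,
    and the symmetry condition at r = 1, k = 1 gives phi 1 <= 1 - phi 0 = 1.
    For maximality, let phi1 >= phi be a gDFF. Then [gDFF_le_symmetry] for phi1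
    gives phi1 r <= (1 - phi1 (1 - k * r)) / k <= (1 - phi (1 - k * r)) / k for
    all k, and the infimum of the last expression over k is phi r. *)

Lemma sumr_nseq (V : nmodType) (T : Type) (f : T -> V) (n : nat) (x : T) :
  \sum_(y <- nseq n x) f y = f x *+ n.
Proof. by rewrite big_nseq -GRing.iter_addr_0. Qed.

(** Families may be taken to be lists, whose concatenation and filtering
    replace any reindexing of finite types. *)
Lemma gDFF_seqP (R : realType) (phi : R -> R) :
  gDFF phi <->
  forall s : seq R, \sum_(x <- s) x <= 1 -> \sum_(x <- s) phi x <= 1.
Proof.
split=> [gphi s | sphi I x].
  have over_ord (f : R -> R) : \sum_(x <- s) f x = \sum_(i < size s) f s`_i.
    by rewrite (big_nth 0) big_mkord.
  by rewrite (over_ord id) (over_ord phi); apply: gphi.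
by have := sphi [seq x i | i <- index_enum I]; rewrite !big_map.
Qed.

(** Raising the value at the single point r keeps the maximality argument down
    to one inequality; a family without r is handled by the gDFF property
    itself, which is why n > 0 may be assumed. *)
Lemma maximal_gDFF_ge (R : realType) (phi : R -> R) (r b : R) :
  maximal_gDFF phi ->
  (forall (n : nat) (t : seq R), (0 < n)%N ->
     r *+ n + \sum_(x <- t) x <= 1 ->
     b *+ n + \sum_(x <- t) phi x <= 1) ->
  b <= phi r.
Proof.
move=> [/gDFF_seqP gphi maxphi] raise_ok.
rewrite leNgt; apply/negP => lt_phi_b; apply: maxphi.
pose phi1 x := if x == r then b else phi x.
exists phi1; split; last 2 first.
- move/(congr1 (fun f => f r)); rewrite /phi1 eqxx => eq_b.
  by rewrite eq_b ltxx in lt_phi_b.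
- by move=> x; rewrite /phi1; case: eqVneq => [->|//]; apply: ltW.
apply/gDFF_seqP => s.
pose t := [seq x <- s | x != r].
have split_sum (f : R -> R) :
    \sum_(x <- s) f x = f r *+ count_mem r s + \sum_(x <- t) f x.
  rewrite (bigID (pred1 r)) big_filter /=; congr (_ + _).
  rewrite (eq_bigr (fun=> f r)) => [|x /eqP-> //].
  by rewrite big_const_seq -GRing.iter_addr_0.
have phi1_t : \sum_(x <- t) phi1 x = \sum_(x <- t) phi x.
  by rewrite !big_filter; apply: eq_bigr => x /negPf; rewrite /phi1 => ->.
rewrite (split_sum id) (split_sum phi1) phi1_t {1}/phi1 eqxx.
case: (posnP (count_mem r s)) => [->|]; last exact: raise_ok.
by rewrite !mulr0n !add0r; apply: gphi.
Qed.

Lemma gDFF_le_symmetry (R : realType) (phi : R -> R) (r : R) (k : nat) :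
  gDFF phi -> (0 < k)%N -> phi r <= k%:R^-1 * (1 - phi (1 - k%:R * r)).
Proof.
move=> /gDFF_seqP gphi k_gt0.
rewrite ler_pdivlMl ?ltr0n // lerBrDr addrC.
have := gphi (1 - k%:R * r :: nseq k r).
by rewrite !big_cons !sumr_nseq -(mulr_natl r) -(mulr_natl (phi r)) subrK; apply.
Qed.

Lemma gDFF0_le0 (R : realType) (phi : R -> R) : gDFF phi -> phi 0 <= 0.
Proof.
move=> /gDFF_seqP gphi; rewrite leNgt; apply/negP => phi0_gt0.
(* Chosen so that n * phi 0 > 1, which a family of n zeros forbids. *)
pose n := (Num.truncn (phi 0)^-1).+1.
have := gphi (nseq n 0); rewrite !sumr_nseq mul0rn => /(_ ler01).
rewrite leNgt -mulr_natl -ltr_pdivrMr // div1r.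
by rewrite truncnS_gt.
Qed.

Lemma maximal_gDFF_ge0 (R : realType) (phi : R -> R) (r : R) :
  maximal_gDFF phi -> 0 <= r -> 0 <= phi r.
Proof.
move=> maxphi r_ge0; apply: (maximal_gDFF_ge maxphi) => n t _ le1.
rewrite mul0rn add0r; apply: (proj1 (gDFF_seqP phi) maxphi.1).
by apply: le_trans le1; rewrite lerDr mulrn_wge0.
Qed.

Lemma maximal_gDFF_superadditive (R : realType) (phi : R -> R) :
  maximal_gDFF phi -> superadditive phi.
Proof.
move=> maxphi x y; apply: (maximal_gDFF_ge maxphi) => n t _.
have := proj1 (gDFF_seqP phi) maxphi.1 (nseq n x ++ nseq n y ++ t).
by rewrite !big_cat !sumr_nseq /= !addrA -!mulrnDl.
Qed.

Lemma superadditive_nondecreasing (R : realType) (phi : R -> R) :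
  superadditive phi -> (forall x, 0 <= x -> 0 <= phi x) ->
  {homo phi : x y / x <= y}.
Proof.
move=> sphi phi_ge0 x y le_xy; rewrite -(subrK x y).
by apply: le_trans (sphi _ _); rewrite lerDr phi_ge0 ?subr_ge0.
Qed.

Lemma superadditive_sum (R : realType) (phi : R -> R) (s : seq R) :
  phi 0 = 0 -> superadditive phi ->
  \sum_(x <- s) phi x <= phi (\sum_(x <- s) x).
Proof.
move=> phi0 sphi; elim: s => [|x s IHs]; first by rewrite !big_nil phi0.
by rewrite !big_cons; apply: le_trans (sphi _ _); rewrite lerD2l.
Qed.

Lemma maximal_gDFF_symmetry (R : realType) (phi : R -> R) :
  maximal_gDFF phi -> phi 0 = 0 -> generalized_symmetry phi.
Proof.
move=> maxphi phi0 r; have gphi := maxphi.1.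
have sphi := maximal_gDFF_superadditive maxphi.
have mono := superadditive_nondecreasing sphi
  (fun x => @maximal_gDFF_ge0 R phi x maxphi).
apply/eqP; rewrite eq_le; apply/andP; split.
  apply/ereal_infP => _ [k /= k_gt0 <-].
  by rewrite lee_fin gDFF_le_symmetry.
set S := (X in ereal_inf X).
have inf_le k : (0 < k)%N ->
    (ereal_inf S <= (k%:R^-1 * (1 - phi (1 - k%:R * r)))%:E)%E.
  by move=> k_gt0; apply: ereal_inf_lbound; exists k.
(* The bound at k = 1 is real, so the infimum is not +oo; if it is -oo there is
   nothing to prove. *)
case: (ereal_inf S) inf_le => [b| |] inf_le; last exact: leNye.
  rewrite lee_fin; apply: (maximal_gDFF_ge maxphi) => n t n_gt0.
  rewrite addrC -lerBrDr => le_t.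
  have := inf_le n n_gt0.
  rewrite lee_fin ler_pdivlMl ?ltr0n // !mulr_natl lerBrDr; apply: le_trans.
  by rewrite lerD2l; apply: le_trans (mono _ _ le_t); apply: superadditive_sum.
by have := inf_le 1 isT.
Qed.

Lemma superadditive_symmetry_gDFF (R : realType) (phi : R -> R) :
  phi 0 = 0 -> superadditive phi -> (forall x, 0 <= x -> 0 <= phi x) ->
  generalized_symmetry phi -> gDFF phi.
Proof.
move=> phi0 sphi phi_ge0 symphi; apply/gDFF_seqP => s le_s1.
apply: le_trans (superadditive_sum s phi0 sphi) _.
apply: le_trans (superadditive_nondecreasing sphi phi_ge0 le_s1) _.
rewrite -lee_fin symphi; apply: ereal_inf_lbound.
by exists 1 => //=; rewrite invr1 !mul1r subrr phi0 subr0.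
Qed.

Lemma gDFF_symmetry_maximal (R : realType) (phi : R -> R) :
  gDFF phi -> generalized_symmetry phi -> maximal_gDFF phi.
Proof.
move=> gphi symphi; split=> // -[phi1 [gphi1 neq_phi le_phi]].
apply: neq_phi; apply/funext => r; apply/eqP.
rewrite eq_le le_phi andbT -lee_fin symphi.
apply/ereal_infP => _ [k /= k_gt0 <-]; rewrite lee_fin.
apply: le_trans (gDFF_le_symmetry r gphi1 k_gt0) _.
by rewrite ler_wpM2l ?invr_ge0 ?ler0n // lerD2l lerN2.
Qed.

Theorem proposition4 (R : realType) (phi : R -> R) :
  maximal_gDFF phi <->
  [/\ phi 0 = 0,
      superadditive phi,
      forall x : R, 0 <= x -> 0 <= phi x
    & generalized_symmetry phi].
Proof.
split=> [maxphi | [phi0 sphi phi_ge0 symphi]].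
  have phi_ge0 x : 0 <= x -> 0 <= phi x by exact: maximal_gDFF_ge0.
  have phi0 : phi 0 = 0.
    by apply/eqP; rewrite eq_le gDFF0_le0 ?phi_ge0 //; exact: maxphi.1.
  split=> //; first exact: maximal_gDFF_superadditive.
  exact: maximal_gDFF_symmetry.
apply: gDFF_symmetry_maximal => //.
exact: superadditive_symmetry_gDFF.
Qed.
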